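(* Let $r\in\{1,2,\dots\}$, $1\le p\le\infty$, $1\le s<\infty$, $\mu>2r-1/s+3/2$. Let $f$ belong to the class $L^\mu_{s,2}$ (that is, $\|f\|_{s,\mu}\le1$), and let the perturbed coefficients satisfy $\|(\langle f-f^\delta,\varphi_{k,j}\rangle)_{k,j\ge0}\|_{\ell_p}\le\delta$, $0<\delta<1$. Then for $n\asymp\left(\delta^{-1}\ln^{1/p-1/s}\frac1\delta\right)^{\frac{1}{\mu-1/p+1/s}}$ the following bound is valid: $$\|f^{(r,r)}-\mathcal D^{(r,r)}_nf^\delta\|_{C}\le c\left(\delta\ln^{1/s-1/p}\tfrac1\delta\right)^{\frac{\mu-2r+1/s-3/2}{\mu-1/p+1/s}}\ln^{2-1/s}\tfrac1\delta .$$
   Context: Let $\varphi_k(t)=\sqrt{k+1/2}\,(2^kk!)^{-1}\frac{d^k}{dt^k}[(t^2-1)^k]$, $k=0,1,2,\dots$, be the Legendre polynomials orthonormal on $[-1,1]$, $Q=[-1,1]^2$, $\varphi_{k,j}(t,\tau)=\varphi_k(t)\varphi_j(\tau)$, and $\langle f,\varphi_{k,j}\rangle=\int_{-1}^1\int_{-1}^1 f(t,\tau)\varphi_k(t)\varphi_j(\tau)\,d\tau\,dt$. $C=C(Q)$ is the space of continuous functions on $Q$ with the uniform norm. $\ell_p$ is the space of double sequences $(x_{k,j})_{k,j\ge0}$ with norm $(\sum|x_{k,j}|^p)^{1/p}$ (supremum if $p=\infty$). The space $L^\mu_{s,2}$ consists of $f\in L_2(Q)$ with $\|f\|_{s,\mu}^s:=\sum_{k,j\ge0}(\underline{k\cdot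 j})^{s\mu}|\langle f,\varphi_{k,j}\rangle|^s<\infty$, where $\underline{m}=\max\{1,m\}$; the class $L^\mu_{s,2}$ is its unit ball. The mixed derivative is understood as the series $f^{(r,r)}(t,\tau)=\sum_{k,j\ge r}\langle f,\varphi_{k,j}\rangle\varphi_k^{(r)}(t)\varphi_j^{(r)}(\tau)$. The perturbed coefficients $\langle f^\delta,\varphi_{k,j}\rangle$, $k,j\ge0$, are a sequence of numbers, known in place of the exact coefficients, satisfying the stated $\ell_p$ condition, where $\langle f-f^\delta,\varphi_{k,j}\rangle$ denotes the difference of the exact and perturbed coefficients. The truncation method is $$\mathcal D_n^{(r,r)}f^\delta(t,\tau)=\sum_{k,j\ge r,\ kj\le rn-1}\langle f^\delta,\varphi_{k,j}\rangle\varphi_k^{(r)}(t)\varphi_j^{(r)}(\tau).$$ For positive quantities, $a\preceq b$ means $a\le c'b$ for some constant $c'>0$, and $a\asymp b$ means $a\preceq b$ and $b\preceq a$. The constant $c>0$ in the bound may depend only on basic parameters such as $\mu,r,p,s$. $\ln^ax=(\ln x)^a$.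
   Formalization: The bound is proved for 0<δ≤δ0, for every δ0<1, with c also depending on δ0 and on the constants in n≍…; a single c for all 0<δ<1 is impossible, e.g. for p=s the right side tends to 0 as δ→1 while a data error δ in coefficient (r,r) keeps the left side bounded below. *)

(* Defs.v *)
(* MathComp-Analysis, over an arbitrary [R : realType]. *)
From mathcomp Require Import all_boot all_order all_algebra finmap.
From mathcomp Require Import all_classical all_reals all_analysis.
From mathcomp Require summability.

Set Implicit Arguments.
Unset Strict Implicit.
Unset Printing Implicit Defensive.

Import Order.TTheory GRing.Theory Num.Theory.
Import numFieldNormedType.Exports.

Local Open Scope classical_set_scope.
Local Open Scope ring_scope.

(* phi_k, orthonormal in L_2[-1,1] *)
Definition legendre (R : realType) (k : nat) : {poly R} :=
  (Num.sqrt (k%:R + 2^-1) * (2 ^+ k * k`!%:R)^-1) *: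
    (('X ^+ 2 - 1) ^+ k)^`(k).

Definition square (R : realType) : set (R * R) :=
  [set z | -1 <= z.1 <= 1 /\ -1 <= z.2 <= 1].

Definition in_L2 (R : realType) (f : R * R -> R) : Prop :=
  measurable_fun (@square R) f /\
  (lebesgue_measure \x lebesgue_measure)%E.-integrable (@square R)
    (fun z => ((f z) ^+ 2)%:E).

Definition coef (R : realType) (f : R * R -> R) (kj : nat * nat) : R :=
  \int[lebesgue_measure]_(t in `[-1, 1])
    \int[lebesgue_measure]_(u in `[-1, 1])
      (f (t, u) * (legendre R kj.1).[t] * (legendre R kj.2).[u]).

(* Only [1 <= p] is meaningful; the value at [p = -oo] is irrelevant. *)
Definition lp_norm (R : realType) (p : \bar R) (x : nat * nat -> R) : \bar R :=
  match p with
  | q%:E => poweR (\esum_(kj in [set: nat * nat]) (`|x kj| `^ q)%:E) q^-1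
  | +oo%E => ereal_sup [set `|x kj|%:E | kj in [set: nat * nat]]
  | -oo%E => 0%E
  end.

Definition wnorm (R : realType) (s mu : R) (f : R * R -> R) : \bar R :=
  poweR (\esum_(kj in [set: nat * nat])
           ((maxn 1 (kj.1 * kj.2))%:R `^ (s * mu) * `|coef f kj| `^ s)%:E)
        s^-1.

Definition in_class (R : realType) (s mu : R) (f : R * R -> R) : Prop :=
  in_L2 f /\ (wnorm s mu f <= 1)%E.

Definition dlegendre2 (R : realType) (r : nat) (kj : nat * nat) (z : R * R) : R :=
  ((legendre R kj.1)^`(r)).[z.1] * ((legendre R kj.2)^`(r)).[z.2].

(* [g] is f^(r,r), i.e. [g] is in C(Q) and is the sum in C(Q) of the series
   over k, j >= r; the double series is summed unconditionally, along the net
   of the finite sets of indices. *)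
Definition is_mixed_deriv (R : realType) (r : nat) (f g : R * R -> R) : Prop :=
  {within @square R, continuous g} /\
  {uniform @square R,
    (fun (A : {fset nat * nat}) (z : R * R) =>
       \sum_(kj <- A | (r <= kj.1)%N && (r <= kj.2)%N)
          coef f kj * dlegendre2 r kj z) @ summability.totally --> g}.

(* For [0 < r], the constraint [k * j <= r * n - 1] with [r <= k, j] forces
   [k, j < r * n], so the ranges of the two sums lose no term. *)
Definition truncation (R : realType) (r n : nat) (x : nat * nat -> R)
    (z : R * R) : R :=
  \sum_(r <= k < r * n) \sum_(r <= j < r * n | (k * j <= r * n - 1)%N)
     x (k, j) * dlegendre2 r (k, j) z.

Definition unorm (R : realType) (g : R * R -> R) : \bar R :=
  ereal_sup [set `|g z|%:E | z in @square R].

(* 1/p, with 1/oo = 0 *)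
Definition rinv (R : realType) (p : \bar R) : R := fine (p^-1)%E.

(* Main.v *)
(* The Legendre equation gives |P_k| <= 1 on [-1, 1], and iterating
   P_(k+2)' = (2k + 3) P_(k+1) + P_k' gives |P_k^(r)| <= k^(2r); hence each term
   of the differentiated series has size at most (3/2) |c_kj| (kj)^(2r + 1/2).
   The part k j >= r n of the series is bounded by Hoelder's inequality in l_s
   together with sum_(kj >= M) (kj)^(-a) <= C M^(1-a) (1 + ln M) for a > 1, and
   the noise on k j < r n by Hoelder's inequality in l_p together with
   #{kj < M} <= M (1 + ln M).  With n as prescribed both contributions are of
   order N^(-(mu - 2r + 1/s - 3/2)) ln^(1 - 1/s)(1/delta), a factor
   ln(1/delta) better than claimed. *)
Require Import Defs.
From mathcomp Require Import all_boot all_order all_algebra.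
From mathcomp Require Import all_classical all_reals all_analysis.
From mathcomp Require Import finmap ring lra zify.
From mathcomp Require summability.

Import Order.TTheory GRing.Theory Num.Theory.
Import numFieldNormedType.Exports.

Local Open Scope classical_set_scope.
Local Open Scope ring_scope.

(** * Legendre polynomials *)

Section Legendre.
Context {R : realType}.
Implicit Types (k n r : nat) (t e : R).

(** Rodrigues' formula for the classical Legendre polynomial P_k, normalised by P_k(1) = 1. *)
Definition stdlegendre k : {poly R} :=
  (2 ^+ k * k`!%:R)^-1 *: (('X ^+ 2 - 1) ^+ k)^`(k).

Lemma legendreE k : legendre R k = Num.sqrt (k%:R + 2^-1) *: stdlegendre k.
Proof. by rewrite /legendre /stdlegendre scalerA. Qed.

Lemma stdlegendre0 : stdlegendre 0 = 1.
Proof. by rewrite /stdlegendre expr0 derivn0 fact0 mul1r invr1 scale1r. Qed.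

Lemma stdlegendre1 : stdlegendre 1 = 'X.
Proof.
rewrite /stdlegendre !expr1 derivn1 derivB derivXn derivC subr0 expr1 mulr1.
by rewrite -[X in _ *: X]scaler_nat scalerA mulVf ?scale1r ?pnatr_eq0.
Qed.

Lemma derivnMX n (p : {poly R}) :
  ('X * p)^`(n) = 'X * p^`(n) + p^`(n.-1) *+ n.
Proof.
case: n => [|n]; first by rewrite addr0.
by have := derivnMXaddC n p 0; rewrite addr0 ![_ * 'X]mulrC addrC.
Qed.

Lemma deriv_sqrB1_exp k : (('X ^+ 2 - 1 : {poly R}) ^+ k.+1)^`() =
  ('X * ('X ^+ 2 - 1) ^+ k) *+ (2 * k.+1).
Proof.
rewrite deriv_exp /= derivB derivXn derivC subr0 expr1 mulrnAl mulrnA.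
by rewrite mulrC.
Qed.

(** With w = X^2 - 1, two derivatives turn w^(k+2) into a combination of w^(k+1) and w^k; the
    remaining k + 1 derivatives yield P_(k+1) and P_k'. *)
Lemma stdlegendre_rec k :
  (stdlegendre k.+2)^`() =
  (2 * k + 3)%:R *: stdlegendre k.+1 + (stdlegendre k)^`().
Proof.
rewrite /stdlegendre !derivZ -!derivnS.
set w : {poly R} := 'X ^+ 2 - 1.
have E : (w ^+ k.+2)^`(2) = (2 * k.+2 * (2 * k + 3))%:R *: w ^+ k.+1
       + (2 * k.+2 * (2 * k.+1))%:R *: w ^+ k.
  rewrite !scaler_nat.
  rewrite derivnS derivn1 deriv_sqrB1_exp derivMn derivM derivX mul1r -/w.
  rewrite deriv_sqrB1_exp -/w.
  have -> : 'X * (('X * w ^+ k) *+ (2 * k.+1)) = (w ^+ k.+1 + w ^+ k) *+ (2 * k.+1).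
    rewrite exprS /w; ring.
  by move: (w ^+ k.+1) (w ^+ k) => a b; ring.
have -> : (w ^+ k.+2)^`(k.+3) = ((w ^+ k.+2)^`(2))^`(k.+1).
  by rewrite /derivn -iterD addn2.
rewrite E derivnD !derivnZ scalerDr !scalerA.
have f0 : k`!%:R != 0 :> R by rewrite pnatr_eq0 -lt0n fact_gt0.
have p0 : 2 ^+ k != 0 :> R by rewrite expf_neq0 ?pnatr_eq0.
congr (_ *: _ + _ *: _).
- rewrite !factS !exprS !natrM; field.
  by rewrite f0 p0 nat1r -natrD !pnatr_eq0.
- rewrite !factS !exprS !natrM; field.
  by rewrite f0 p0 nat1r -natrD !pnatr_eq0.
Qed.

(** Take k + 1 derivatives of w (w^k)' = 2 k X w^k, where w = X^2 - 1, by Leibniz' rule. *)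
Lemma stdlegendre_ode k :
  ('X ^+ 2 - 1) * (stdlegendre k)^`(2) + 'X * (stdlegendre k)^`() *+ 2 =
  stdlegendre k *+ (k * k.+1).
Proof.
rewrite /stdlegendre; set w : {poly R} := 'X ^+ 2 - 1; set c := (_ * _)^-1.
rewrite derivnZ derivZ -!scalerAr !scalerMnr -scalerDr; congr (_ *: _).
have E : 'X * ('X * (w ^+ k)^`()) - (w ^+ k)^`() = ('X * w ^+ k) *+ (2 * k).
  case: k c => [|k] c; first by rewrite expr0 derivC !mulr0 subr0.
  by rewrite deriv_sqrB1_exp -/w exprS /w; ring.
move: E => /(congr1 (derivn k.+1)).
rewrite derivnB derivnMn !derivnMX /=.
have H n : derivn n (w ^+ k)^`() = (w ^+ k)^`(n.+1) by rewrite -derivSn.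
rewrite !H.
(* At k = 0 the two orders of differentiation differ, but the multiplier k makes both sides zero. *)
have -> : (w ^+ k)^`(k.-1.+1) *+ k = (w ^+ k)^`(k) *+ k by case: (k).
set u0 := (w ^+ k)^`(k); set u1 := (w ^+ k)^`(k.+1).
have -> : u0^`() = u1 by [].
set u2 := u1^`().
move=> E; apply: (addIr ('X * u1 *+ (2 * k) + u0 *+ (k * k.+1))).
transitivity ('X * ('X * u2 + u1 *+ k.+1) + ('X * u1 + u0 *+ k) *+ k.+1 - u2).
  rewrite /w; ring.
rewrite E; ring.
Qed.

(** Where e^2 = 1 the Legendre equation degenerates to 2 e P_n'(e) = n (n + 1) P_n(e), which turns
    the recurrence for derivatives into one for values. *)
Lemma stdlegendre_end k e : e ^+ 2 = 1 -> (stdlegendre k).[e] = e ^+ k.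
Proof.
move=> e2.
have ode n : ((stdlegendre n)^`()).[e] = e * (n * n.+1)%:R / 2 * (stdlegendre n).[e].
  have := congr1 (horner^~ e) (stdlegendre_ode n).
  rewrite hornerD hornerM !hornerMn hornerM hornerX hornerD hornerN hornerXn.
  rewrite hornerC e2 subrr mul0r add0r => H.
  have -> : (stdlegendre n)^`().[e] = e * (e * (stdlegendre n)^`().[e]).
    by rewrite mulrA -expr2 e2 mul1r.
  suff -> : e * (stdlegendre n)^`().[e] = (stdlegendre n).[e] *+ (n * n.+1) / 2.
    by rewrite -[(stdlegendre n).[e] *+ _]mulr_natl; ring.
  by rewrite -H; field.
suff: (stdlegendre k).[e] = e ^+ k /\ (stdlegendre k.+1).[e] = e ^+ k.+1 by case.
elim: k => [|k [IH0 IH1]]; first by rewrite stdlegendre0 stdlegendre1 !hornerE.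
split=> //.
have := congr1 (horner^~ e) (stdlegendre_rec k).
rewrite hornerD hornerZ !ode IH0 IH1 => H.
have e0 : e != 0 by apply/eqP => e0; move: e2; rewrite e0 expr0n /=; lra.
have c0 : e * (k.+2 * k.+3)%:R / 2 != 0.
  by rewrite !mulf_neq0// ?invr_eq0 ?pnatr_eq0.
apply: (mulfI c0); rewrite H !exprS.
rewrite -[RHS](_ : e ^+ 2 * (e * e ^+ k * ((k.+2 * k.+3)%:R / 2)) = _).
  by rewrite e2 mul1r !natrM -!natr1; field.
by rewrite natrM; ring.
Qed.
End Legendre.

(** * Bounds for Legendre polynomials and their derivatives on [-1, 1] *)

Section LegendreBound.
Context {R : realType}.
Implicit Types (k n r : nat) (t e : R).

(* For k >= 1, P_k^2 + (1 - X^2) P_k'^2 / (k (k + 1)) dominates P_k^2 and equals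
   1 at both endpoints; by the Legendre equation its derivative is
   2 X P_k'^2 / (k (k + 1)), so it is largest at the endpoints. *)
Lemma stdlegendre_le1 k t : -1 <= t <= 1 -> `|(stdlegendre k).[t]| <= 1.
Proof.
case: k => [|k]; first by rewrite stdlegendre0 hornerC normr1.
move=> /andP[t1 t2].
set P : {poly R} := stdlegendre k.+1; set m := (k.+1 * k.+2)%N.
pose h : {poly R} := P ^+ 2 *+ m + (1 - 'X ^+ 2) * P^`() ^+ 2.
have h' : h^`() = 'X * P^`() ^+ 2 *+ 2.
  rewrite /h derivD derivMn deriv_exp derivM deriv_exp derivB derivXn derivC /=.
  have E := @stdlegendre_ode R k.+1; rewrite -/P -/m in E.
  rewrite !expr1 sub0r.
  transitivity (P^`() * (P *+ m) *+ 2 + (- ('X *+ 2) * P^`() ^+ 2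
    + (1 - 'X ^+ 2) * (P^`()^`() * P^`() *+ 2))); last by rewrite -E; ring.
  by ring.
have hx x : h.[x] = P.[x] ^+ 2 *+ m + (1 - x ^+ 2) * P^`().[x] ^+ 2.
  rewrite /h hornerD hornerMn horner_exp hornerM hornerD hornerN !horner_exp.
  by rewrite hornerX hornerC.
have h'x x : (horner h)^`()%classic x = x * P^`().[x] ^+ 2 *+ 2.
  by rewrite -derivE h' hornerMn hornerM hornerX horner_exp.
have ch (a b : R) : {within `[a, b], continuous (horner h)}.
  by apply: continuous_subspaceT; exact: continuous_horner.
have hend e : e ^+ 2 = 1 -> h.[e] = m%:R.
  by move=> e2; rewrite hx stdlegendre_end// e2 subrr mul0r addr0 exprAC e2 expr1n.
have hm : h.[t] <= m%:R.
  have [t0|t0] := leP 0 t.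
    rewrite -(hend 1) ?expr1n//.
    apply: (@ger0_derive1_ndecr R (horner h) 0 1) => // x.
    rewrite in_itv /= => /andP[x0 _].
    by rewrite h'x mulrn_wge0// mulr_ge0 ?sqr_ge0// ltW.
  rewrite -(hend (-1)) ?sqrrN ?expr1n//.
  apply: (@ler0_derive1_nincr R (horner h) (-1) 0) => // [x|].
  - rewrite in_itv /= => /andP[_ x0].
    by rewrite h'x mulrn_wle0// mulr_le0_ge0 ?sqr_ge0// ltW.
  - exact: ltW.
have : P.[t] ^+ 2 *+ m <= 1 *+ m.
  apply: le_trans hm; rewrite hx lerDl mulr_ge0 ?sqr_ge0// subr_ge0.
  by rewrite expr2; nra.
rewrite ler_pMn2r// -[leRHS](expr1n _ 2) => H.
by rewrite -(ler_pXn2r (n := 2)) ?nnegrE// real_normK ?num_real.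
Qed.

(** Differentiated r times, the recurrence reads P_(k+2)^(r+1) = (2k + 3) P_(k+1)^(r) + P_k^(r+1);
    the induction closes because 2k + 3 + k^2 <= (k + 2)^2. *)
Lemma stdlegendre_derivn_le k r t : -1 <= t <= 1 ->
  `|((stdlegendre k)^`(r)).[t]| <= (k ^ (2 * r))%:R.
Proof.
move=> ht; elim: r k => [|r IH] k; first by rewrite muln0 expn0 stdlegendre_le1.
suff: `|((stdlegendre k)^`(r.+1)).[t]| <= (k ^ (2 * r.+1))%:R /\
      `|((stdlegendre k.+1)^`(r.+1)).[t]| <= (k.+1 ^ (2 * r.+1))%:R by case.
elim: k => [|k [IH0 IH1]].
  rewrite stdlegendre0 stdlegendre1 !derivSn derivC derivX linear0 horner0 normr0 exp1n.
  by split=> //; rewrite derivnC; case: eqP => _; rewrite hornerC ?normr1 ?normr0.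
split=> //; rewrite derivSn stdlegendre_rec derivnD derivnZ -derivSn hornerD hornerZ.
rewrite (le_trans (ler_normD _ _))// normrM normr_nat.
apply: (@le_trans _ _ ((2 * k + 3)%:R * (k.+1 ^ (2 * r))%:R + (k ^ (2 * r.+1))%:R)).
  by rewrite lerD// ler_wpM2l.
have E (a : nat) : (a ^ (2 * r.+1) = a ^ 2 * a ^ (2 * r))%N.
  by rewrite mulnS expnD.
rewrite -natrM -natrD ler_nat !E.
have mono (a b e : nat) : (a <= b)%N -> (a ^ e <= b ^ e)%N.
  by case: e => // e; rewrite leq_exp2r.
have Hx := mono k.+1 k.+2 (2 * r)%N (leqnSn _).
have Hy := mono k k.+2 (2 * r)%N (leqW (leqnSn _)).
apply: leq_trans (leq_add (leq_mul (leqnn _) Hx) (leq_mul (leqnn _) Hy)) _.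
have H2 : (2 * k + 3 + k ^ 2 <= k.+2 ^ 2)%N by lia.
by rewrite -mulnDl leq_mul2r H2 orbT.
Qed.

(** The normalisation satisfies sqrt(i + 1/2) <= sqrt(3/2) i^(1/2) for i >= 1, so each variable adds
    a factor sqrt(3/2) and 1/2 to the exponent. *)
Lemma dlegendre2_le r k j (z : R * R) : (1 <= k)%N -> (1 <= j)%N -> square z ->
  `|dlegendre2 r (k, j) z| <= 3 / 2 * (k * j)%:R `^ (2 * r%:R + 2^-1).
Proof.
move=> k1 j1 [z1 z2].
have H (i : nat) (t : R) : (1 <= i)%N -> -1 <= t <= 1 ->
    `|((legendre R i)^`(r)).[t]| <= Num.sqrt (3 / 2) * i%:R `^ (2 * r%:R + 2^-1).
  move=> i1 ht; have i1' : 1 <= i%:R :> R by rewrite ler1n.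
  rewrite legendreE derivnZ hornerZ normrM ger0_norm ?sqrtr_ge0//.
  rewrite powRD; last by rewrite pnatr_eq0 -lt0n i1 implybT.
  rewrite -natrM powR_mulrn// powR12_sqrt// -natrX [X in _ <= _ * X]mulrC mulrA.
  rewrite -sqrtrM; last lra.
  by rewrite ler_pM ?sqrtr_ge0 ?stdlegendre_derivn_le// ler_wsqrtr//; lra.
rewrite /dlegendre2 /= normrM.
apply: le_trans (ler_pM _ _ (H _ _ k1 z1) (H _ _ j1 z2)) _ => //.
rewrite mulrACA -expr2 sqr_sqrtr; last lra.
by rewrite natrM powRM.
Qed.
End LegendreBound.

(** * Sums over hyperbolic regions *)

Section HyperbolicSums.
Context {R : realType}.
Implicit Types (k j n M J K : nat) (a b : R).

(** This is ln (1 + x) <= x at x = -1/(n + 1). *)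
Lemma ln_le_succ n : (1 <= n)%N -> n.+1%:R^-1 <= ln n.+1%:R - ln n%:R :> R.
Proof.
move=> n1; have n0 : 0 < n%:R :> R by rewrite ltr0n.
rewrite -[leRHS]opprK opprB -ln_div ?posrE// lerNr.
have -> : n%:R / n.+1%:R = 1 + - n.+1%:R^-1 :> R.
  by rewrite -natr1; field; rewrite natr1.
by apply: le_ln1Dx; rewrite ltrN2 invf_lt1 // ltr1n.
Qed.

Lemma harmonic_sum_le M : (1 <= M)%N ->
  \sum_(1 <= k < M.+1) k%:R^-1 <= 1 + ln M%:R :> R.
Proof.
elim: M => // -[_ _|M IH _]; first by rewrite big_nat1 invr1 ln1 addr0.
rewrite big_nat_recr //=.
apply: le_trans (lerD (IH isT) (ln_le_succ M.+1 isT)) _.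
by rewrite -addrA subrKC.
Qed.

(** Discrete counterpart of integrating x^(-a). Writing ((j+1)/j)^(a-1) as an exponential gives the
    bound with (j+1)^(-a); passing to j^(-a) costs 2^a, since j + 1 <= 2j. *)
Lemma powR_telescope a j : 1 < a -> (1 <= j)%N ->
  (a - 1) / 2 `^ a * j%:R `^ (- a) <= j%:R `^ (1 - a) - j.+1%:R `^ (1 - a).
Proof.
move=> a1 j1; have j0 : 0 < j%:R :> R by rewrite ltr0n.
have S0 : 0 < j.+1%:R :> R by [].
apply: (@le_trans _ _ ((a - 1) * j.+1%:R `^ (- a))).
  rewrite -mulrA ler_pM2l ?subr_gt0// !powRN -invfM -powRM//.
  rewrite lef_pV2 ?posrE ?powR_gt0 ?mulr_gt0// ge0_ler_powR ?nnegrE//; first lra.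
  by rewrite -natrM ler_nat; lia.
have -> : j.+1%:R `^ (- a) = j.+1%:R `^ (1 - a) / j.+1%:R.
  rewrite -[X in _ / X]powRr1// -powRN -powRD; last by rewrite pnatr_eq0 implybT.
  by congr powR; ring.
have -> : j%:R `^ (1 - a) = j.+1%:R `^ (1 - a) * (j.+1%:R / j%:R) `^ (a - 1).
  rewrite powRM ?invr_ge0// -powR_inv1// -powRrM mulrA -powRD; last first.
    by rewrite pnatr_eq0 implybT.
  have -> : 1 - a + (a - 1) = 0 by ring.
  by rewrite powRr0 mul1r; congr powR; ring.
rewrite mulrCA -[X in _ <= _ - X]mulr1 -mulrBr ler_wpM2l ?powR_ge0//.
rewrite lerBrDl /powR gt_eqF ?divr_gt0//.
apply: le_trans (expR_ge1Dx _); rewrite lerD2l ler_wpM2l ?subr_ge0 ?(ltW a1)//.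
by rewrite ln_div ?posrE// ln_le_succ.
Qed.

(** The sum is dominated by a telescoping one; uniformity in [K] lets finite sums stand for the
    infinite tail. *)
Lemma power_tail_le a : 1 < a -> exists2 C : R, 0 < C &
  forall J K, (1 <= J)%N ->
    \sum_(J <= j < K) j%:R `^ (- a) <= C * J%:R `^ (1 - a).
Proof.
move=> a1; exists (2 `^ a / (a - 1)) => [|J K J1].
  by rewrite divr_gt0 ?powR_gt0 ?subr_gt0.
have [KJ|/ltnW JK] := leqP K J.
  by rewrite big_geq// mulr_ge0 ?powR_ge0// divr_ge0 ?powR_ge0// subr_ge0 ltW.
rewrite -invf_div -ler_pdivrMl ?invr_gt0 ?divr_gt0 ?powR_gt0 ?subr_gt0// invrK.
rewrite big_distrr /=.
apply: (@le_trans _ _ (\sum_(J <= j < K) (j%:R `^ (1 - a) - j.+1%:R `^ (1 - a)))).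
  rewrite big_nat_cond [leRHS]big_nat_cond ler_sum// => j /andP[/andP[Jj _] _].
  by rewrite powR_telescope// (leq_trans J1).
rewrite -[leLHS]opprK -sumrN.
under eq_bigr do rewrite opprB.
by rewrite (telescope_sumr (fun j => j%:R `^ (1 - a)))// opprB gerBl powR_ge0.
Qed.

(** For fixed k the sum over j is a power tail starting at the ceiling of M/k. For k <= M it is at
    most C M^(1-a)/k, which leads to a harmonic sum; for k > M it is at most C k^(-a), again a power
    tail. *)
Lemma hyperbolic_tail_le a : 1 < a -> exists2 C : R, 0 < C &
  forall M K, (1 <= M)%N -> (M < K)%N ->
    \sum_(1 <= k < K) \sum_(1 <= j < K | (M <= k * j)%N) (k * j)%:R `^ (- a)
      <= C * M%:R `^ (1 - a) * (1 + ln M%:R).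
Proof.
move=> a1; have [C C0 HC] := power_tail_le _ a1.
exists (C * (1 + C)) => [|M K M1 MK]; first by rewrite mulr_gt0// addr_gt0.
have M0 : 0 < M%:R :> R by rewrite ltr0n.
(* [(M.-1 %/ k).+1] is the ceiling of M/k. *)
have inner k : (1 <= k)%N ->
    \sum_(1 <= j < K | (M <= k * j)%N) (k * j)%:R `^ (- a) <=
    C * (k%:R `^ (- a) * (M.-1 %/ k).+1%:R `^ (1 - a)).
  move=> k1; rewrite mulrCA.
  under eq_bigr do rewrite natrM powRM//.
  rewrite -big_distrr /= ler_wpM2l ?powR_ge0//.
  apply: le_trans (HC (M.-1 %/ k).+1 K isT).
  rewrite (@big_nat_widenl _ _ _ (M.-1 %/ k).+1 1)//= le_eqVlt.
  apply/orP; left; apply/eqP; apply: eq_bigl => j.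
  by rewrite ltn_divLR// mulnC prednK.
have lnM : 0 <= ln M%:R :> R by rewrite ln_ge0// ler1n.
rewrite (@big_cat_nat _ _ _ M.+1)//=.
rewrite -!mulrA mulrDl mul1r mulrDr; apply: lerD.
  apply: (@le_trans _ _ (C * (M%:R `^ (1 - a) * \sum_(1 <= k < M.+1) k%:R^-1))).
    rewrite !big_distrr /= big_nat_cond [leRHS]big_nat_cond.
    apply: ler_sum => k /andP[/andP[k1 kM] _].
    apply: le_trans (inner _ k1) _; rewrite ler_wpM2l ?(ltW C0)//.
    have k0 : 0 < k%:R :> R by rewrite ltr0n.
    have -> : M%:R `^ (1 - a) / k%:R = k%:R `^ (- a) * (M%:R / k%:R) `^ (1 - a).
      rewrite powRM ?invr_ge0// mulrCA; congr (_ * _).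
      rewrite -!powR_inv1// -powRrM -powRD; last by rewrite pnatr_eq0 -lt0n k1 implybT.
      by congr powR; ring.
    rewrite ler_wpM2l ?powR_ge0// -opprB !powRN lef_pV2 ?posrE ?powR_gt0 ?divr_gt0//.
    rewrite ge0_ler_powR ?nnegrE ?divr_ge0//; first lra.
    rewrite ler_pdivrMr// -natrM ler_nat.
    by rewrite -[leqLHS]prednK// -ltn_divLR.
  by rewrite ler_wpM2l ?(ltW C0)// ler_wpM2l ?powR_ge0// harmonic_sum_le.
apply: (@le_trans _ _ (C * \sum_(M.+1 <= k < K) k%:R `^ (- a))).
  rewrite big_distrr /= big_nat_cond [leRHS]big_nat_cond.
  apply: ler_sum => k /andP[/andP[k1 kM] _].
  apply: le_trans (inner _ (leq_trans _ k1)) _ => //.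
  rewrite ler_wpM2l ?(ltW C0)// ler_piMr ?powR_ge0//.
  by rewrite -[leRHS](powRr0 (M.-1 %/ k).+1%:R) ler_powR ?ler1n//; lra.
rewrite ler_wpM2l ?(ltW C0)//; apply: le_trans (HC M.+1 K isT) _.
rewrite ler_wpM2l ?(ltW C0)//.
apply: (@le_trans _ _ (M%:R `^ (1 - a))); last by rewrite ler_peMr ?powR_ge0// lerDl.
rewrite -opprB !powRN lef_pV2 ?posrE ?powR_gt0//.
by rewrite ge0_ler_powR ?nnegrE// ?ler_nat//; lra.
Qed.

(** Each k admits at most M/k values of j, whence a harmonic sum. *)
Lemma hyperbolic_count_le M r : (1 <= M)%N -> (1 <= r)%N ->
  \sum_(r <= k < M) \sum_(r <= j < M | (k * j <= M - 1)%N) 1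
    <= M%:R * (1 + ln M%:R) :> R.
Proof.
move=> M1 r1.
apply: (@le_trans _ _ (\sum_(1 <= k < M.+1) M%:R / k%:R)).
  rewrite (@big_nat_widenl _ _ _ r 1)// big_mkcond /= big_nat_recr //=.
  rewrite -[leLHS]addr0 lerD ?divr_ge0//.
  rewrite big_nat_cond [leRHS]big_nat_cond.
  apply: ler_sum => k /andP[/andP[k1 kM] _].
  case: ifP => _; last by rewrite divr_ge0.
  rewrite ler_pdivlMr ?ltr0n//.
  have -> : \sum_(r <= j < M | (k * j <= M - 1)%N) 1 =
      (\sum_(r <= j < M | (k * j <= M - 1)%N) 1)%:R :> R by rewrite natr_sum.
  rewrite -natrM ler_nat.
  rewrite -leq_divRL//.
  apply: (@leq_trans (\sum_(1 <= j < (M %/ k).+1) 1)%N); last first.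
    by rewrite sum_nat_const_nat muln1 subn1.
  rewrite (@big_nat_widenl _ _ _ r 1)// big_mkcond /=.
  rewrite [leqRHS](@big_nat_widen _ _ _ 1 _ M.+1); last first.
    by rewrite ltnS leq_div.
  rewrite [leqRHS]big_mkcond big_nat_recr//= -[leqLHS]addn0 leq_add//.
  apply: leq_sum => j _; case: ifP => // /andP[H _].
  rewrite ltnS leq_divRL// mulnC ifT//; lia.
rewrite -big_distrr /= ler_wpM2l// harmonic_sum_le//.
Qed.

(** * Hoelder's inequality for finite sums *)

(** Young's inequality, applied termwise to x_i/D and w_i/W. Positive upper bounds [D] and [W] in
    place of the norms avoid a division by zero. *)
Lemma holder_sum (I : Type) (l : seq I) (P : pred I) (x w : I -> R) p q (D W : R) :
  (forall i, 0 <= x i) -> (forall i, 0 <= w i) ->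
  0 < p -> 0 < q -> p^-1 + q^-1 = 1 -> 0 < D -> 0 < W ->
  \sum_(i <- l | P i) x i `^ p <= D `^ p ->
  \sum_(i <- l | P i) w i `^ q <= W `^ q ->
  \sum_(i <- l | P i) x i * w i <= D * W.
Proof.
move=> x0 w0 p0 q0 pq D0 W0 hx hw.
rewrite -[leRHS]mul1r -ler_pdivrMr ?mulr_gt0// big_distrl /= -[leRHS]pq.
apply: (@le_trans _ _ (\sum_(i <- l | P i)
    ((x i / D) `^ p / p + (w i / W) `^ q / q))).
  apply: ler_sum => i _; rewrite invfM mulrACA.
  by apply: conjugate_powR; rewrite ?divr_ge0// ltW.
rewrite big_split /= -!big_distrl /=.
have aux (u : I -> R) (t U : R) : (forall i, 0 <= u i) -> 0 < t -> 0 < U ->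
    \sum_(i <- l | P i) u i `^ t <= U `^ t ->
    (\sum_(i <- l | P i) (u i / U) `^ t) / t <= t^-1.
  move=> u0 t0 U0 hu; rewrite ler_piMl ?invr_ge0 ?(ltW t0)//.
  under eq_bigr do rewrite powRM ?invr_ge0 ?(ltW U0)//.
  rewrite -big_distrl /= -(powR_inv1 (ltW U0)) -powRrM mulN1r powRN.
  by rewrite ler_pdivrMr ?powR_gt0// mul1r.
by rewrite lerD ?aux.
Qed.

Lemma sum_le_powR_card (I : Type) (l : seq I) (P : pred I) (x : I -> R) (p D S : R) :
  (forall i, 0 <= x i) -> 1 <= p -> 0 < D -> 0 < S ->
  \sum_(i <- l | P i) x i `^ p <= D `^ p ->
  \sum_(i <- l | P i) 1 <= S ->
  \sum_(i <- l | P i) x i <= D * S `^ (1 - p^-1).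
Proof.
move=> x0 p1 D0 S0 hx hS; have p0 : 0 < p by apply: lt_le_trans p1.
(* For p = 1 the conjugate exponent is infinite, but the claim is then the hypothesis itself. *)
move: p1; rewrite le_eqVlt => /predU1P[p1|p1].
  move: hx; rewrite -p1 invr1 subrr powRr0 mulr1 powRr1 ?(ltW D0)//.
  by under eq_bigr do rewrite powRr1//.
have c0 : 0 < 1 - p^-1 by rewrite subr_gt0 invf_lt1.
under eq_bigr do rewrite -[x _]mulr1.
apply: (@holder_sum _ _ _ _ _ p (1 - p^-1)^-1) => //; rewrite ?invr_gt0 ?powR_gt0//.
  by rewrite invrK subrKC.
by rewrite -powRrM mulfV ?gt_eqF// powRr1 ?(ltW S0)//; under eq_bigr do rewrite powR1.
Qed.
End HyperbolicSums.

(** * Rates in terms of the noise level *)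

Section Rate.
Context {R : realType}.

(** To be used with e = 1/p, sg = 1/s, be = mu - e + sg, ga = mu - 2r + sg - 3/2 and M = r n: the
    first summand is the truncation error, the second the noise. The choice of N balances them: both
    are O(N^(-ga) L^(1-sg)). *)
Lemma error_rate (be ga e sg c1 c2 d0 K1 K2 : R) :
  0 < be -> 0 <= ga <= be -> 0 <= e <= 1 -> 0 <= sg <= 1 ->
  0 < c1 -> 0 < c2 -> 0 < d0 < 1 -> 0 < K1 -> 0 < K2 ->
  exists2 c : R, 0 < c & forall d M : R, 0 < d <= d0 -> 1 <= M ->
    let L := ln d^-1 in
    let N := (d^-1 * L `^ (e - sg)) `^ (1 / be) in
    c1 * N <= M <= c2 * N ->
    K1 * M `^ (- ga) * (1 + ln M) `^ (1 - sg)
      + K2 * M `^ (be - ga - (1 - e)) * (d * (M * (1 + ln M)) `^ (1 - e))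
      <= c * (d * L `^ (sg - e)) `^ (ga / be) * L `^ (2 - sg).
Proof.
move=> be0 /andP[ga0 gabe] /andP[e0 e1] /andP[sg0 sg1] c10 c20.
move=> /andP[d00 d01] K10 K20.
(* A positive lower bound for L on the range d <= d0; it absorbs additive constants into multiples
   of L. *)
pose L0 := ln d0^-1.
have L00 : 0 < L0 by rewrite ln_gt0// invf_gt1.
(* Chosen so that 1 + ln M <= K3 L: constants are at most their multiples by L/L0, and ln N <= (2 L
   + |ln L0|)/be. *)
pose K3 := (1 + `|ln c2| + `|ln L0| / be) / L0 + 2 / be.
have K30 : 0 < K3.
  by rewrite addr_gt0 ?divr_gt0// -addrA ltr_pwDl// addr_ge0// divr_ge0// ltW.
pose c := (K1 * c1 `^ (- ga) * K3 `^ (1 - sg)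
           + K2 * c2 `^ (be - ga) * K3 `^ (1 - e)) / L0.
have c0 : 0 < c by rewrite divr_gt0// addr_gt0// !mulr_gt0// powR_gt0.
exists c => // d M /andP[d0' dd0] M1 L N /andP[NM MN].
have L0L : L0 <= L by rewrite ler_ln ?posrE ?invr_gt0// lef_pV2.
have L_gt0 : 0 < L by apply: lt_le_trans L0L.
have LE : L = ln d^-1 by [].
have NX : N = (d^-1 * L `^ (e - sg)) `^ (1 / be) by [].
clearbody N L.
have X0 : 0 < d^-1 * L `^ (e - sg) by rewrite mulr_gt0 ?invr_gt0 ?powR_gt0.
have N0 : 0 < N by rewrite NX powR_gt0.
have M0 : 0 < M by apply: lt_le_trans M1.
have lnM0 : 0 <= ln M by rewrite ln_ge0.
have lnM : 1 + ln M <= K3 * L.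
  (* Here |e - sg| <= 1, while ln L <= L and -ln L <= |ln L0|. *)
  have lnL : (e - sg) * ln L <= L + `|ln L0|.
    apply: (@le_trans _ _ `|ln L|).
      apply: le_trans (ler_norm _) _; rewrite normrM ler_piMl//.
      by rewrite ler_norml; apply/andP; split; lra.
    rewrite ler_norml; apply/andP; split.
      have : ln L0 <= ln L by rewrite ler_ln.
      have := ler_norm (- ln L0); rewrite normrN; lra.
    by rewrite ler_wpDr// ltW// ln_sublinear.
  have : ln M <= ln (c2 * N) by rewrite ler_ln ?posrE ?mulr_gt0.
  rewrite lnM ?posrE//.
  rewrite NX ln_powR lnM ?posrE ?powR_gt0 ?invr_gt0// ln_powR -LE => H.
  have h2 : 1 / be * (L + (e - sg) * ln L) <= 1 / be * (L + (L + `|ln L0|)).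
    by rewrite ler_wpM2l ?divr_ge0 ?(ltW be0)// lerD2l.
  have h3 : ln c2 <= `|ln c2| by exact: ler_norm.
  have h4 : (1 + `|ln c2| + `|ln L0| / be) <=
       (1 + `|ln c2| + `|ln L0| / be) / L0 * L.
    rewrite mulrAC ler_pdivlMr// ler_wpM2l//.
    by rewrite addr_ge0 ?divr_ge0 ?addr_ge0// ltW.
  rewrite /K3 mulrDl; apply: le_trans (lerD h4 (lexx _)).
  apply: le_trans (lerD (lexx 1) (le_trans H (lerD h3 h2))) _.
  by rewrite le_eqVlt; apply/orP; left; apply/eqP; field; rewrite gt_eqF.
have NE : N `^ (- ga) = (d * L `^ (sg - e)) `^ (ga / be).
  have -> : d * L `^ (sg - e) = (d^-1 * L `^ (e - sg))^-1.
    by rewrite invfM invrK -powRN opprB.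
  rewrite NX; move: (_ * _) X0 => x x0.
  rewrite -(powR_inv1 (ltW x0)) -!powRrM; congr (_ `^ _); field.
  by rewrite gt_eqF.
(* The balance: noise of size d N^(be - ga) becomes N^(-ga) times a power of L. *)
have dN : d * N `^ be = L `^ (e - sg).
  by rewrite NX -powRrM divfK ?gt_eqF// powRr1 ?(ltW X0)// mulVKf ?gt_eqF.
have mono x y t : 0 <= t -> 0 < x -> 0 < y -> x <= y -> x `^ t <= y `^ t.
  by move=> t0 x0 y0 xy; rewrite ge0_ler_powR ?nnegrE ?(ltW x0) ?(ltW y0).
have pMN t : 0 <= t -> M `^ t <= c2 `^ t * N `^ t.
  by move=> t0; rewrite -powRM ?(ltW c20) ?(ltW N0)// mono// mulr_gt0.
have nMN t : 0 <= t -> M `^ (- t) <= c1 `^ (- t) * N `^ (- t).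
  move=> t0; rewrite -powRM ?(ltW c10) ?(ltW N0)// !powRN.
  by rewrite lef_pV2 ?posrE ?powR_gt0 ?mulr_gt0// mono// mulr_gt0.
have lnM1 : 0 < 1 + ln M by rewrite ltr_wpDr.
have plnM t : 0 <= t -> (1 + ln M) `^ t <= K3 `^ t * L `^ t.
  by move=> t0; rewrite -powRM ?(ltW K30) ?(ltW L_gt0)// mono// mulr_gt0.
rewrite -NE.
(* The intermediate bound has one logarithm less than the claim; L0 <= L makes up for it. *)
apply: (@le_trans _ _ (c * L0 * (N `^ (- ga) * L `^ (1 - sg)))); last first.
  have -> : 2 - sg = (1 - sg) + 1 by ring.
  rewrite (@powRD _ L (1 - sg)) ?(gt_eqF L_gt0) ?implybT// powRr1 ?(ltW L_gt0)//.
  rewrite mulrA [leLHS](_ : _ = c * N `^ (- ga) * (L `^ (1 - sg) * L0)).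
    apply: ler_wpM2l; first by rewrite mulr_ge0 ?powR_ge0 ?(ltW c0).
    by rewrite ler_wpM2l ?powR_ge0.
  ring.
rewrite /c divfK ?(gt_eqF L00)// mulrDl; apply: lerD.
  rewrite -!mulrA ler_pM2l// [leRHS](_ : _ =
     (c1 `^ (- ga) * N `^ (- ga)) * (K3 `^ (1 - sg) * L `^ (1 - sg))); last by ring.
  by rewrite ler_pM ?powR_ge0 ?nMN ?plnM// subr_ge0.
rewrite -!mulrA ler_pM2l//.
rewrite powRM ?(ltW M0) ?(ltW lnM1)//.
rewrite [leLHS](_ : _ = d * (M `^ (be - ga - (1 - e)) * M `^ (1 - e))
    * (1 + ln M) `^ (1 - e)); last by ring.
rewrite -powRD ?(gt_eqF M0) ?implybT// subrK.
rewrite [leRHS](_ : _ = d * (c2 `^ (be - ga) * N `^ (be - ga))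
    * (K3 `^ (1 - e) * L `^ (1 - e))).
  rewrite ler_pM ?mulr_ge0 ?powR_ge0 ?(ltW d0')//.
    by rewrite ler_pM2l// pMN// subr_ge0.
  by rewrite plnM// subr_ge0.
rewrite (@powRD _ N be) ?(gt_eqF N0) ?implybT//.
have -> : 1 - sg = (e - sg) + (1 - e) by ring.
rewrite (@powRD _ L (e - sg)) ?(gt_eqF L_gt0) ?implybT// -dN; ring.
Qed.

End Rate.

(** * Unconditional summation *)

Section FiniteSums.
Context {R : realType} {I : choiceType}.
Implicit Types (A B : {fset I}) (P Q : pred I) (F : I -> R).

Lemma sum_le_pred (l : seq I) P Q F : (forall i, 0 <= F i) ->
  (forall i, i \in l -> P i -> Q i) ->
  \sum_(i <- l | P i) F i <= \sum_(i <- l | Q i) F i.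
Proof.
move=> F0 PQ; rewrite big_mkcond [leRHS]big_mkcond.
rewrite big_seq_cond [leRHS]big_seq_cond.
apply: ler_sum => i /andP[il _]; case: ifP => [/(PQ _ il) ->//|_].
by case: ifP.
Qed.

Lemma eq_sum_mem (l1 l2 : seq I) P F : uniq l1 -> uniq l2 ->
  (forall i, P i -> (i \in l1) = (i \in l2)) ->
  \sum_(i <- l1 | P i) F i = \sum_(i <- l2 | P i) F i.
Proof.
move=> u1 u2 H; rewrite -big_filter -[RHS]big_filter; apply: perm_big.
apply: uniq_perm; rewrite ?filter_uniq// => i; rewrite !mem_filter.
by case Pi : (P i) => //=; exact: H.
Qed.

Lemma sum_le_subset (l1 l2 : seq I) P F : uniq l1 -> uniq l2 ->
  (forall i, 0 <= F i) -> {subset l1 <= l2} ->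
  \sum_(i <- l1 | P i) F i <= \sum_(i <- l2 | P i) F i.
Proof.
move=> u1 u2 F0 sub.
rewrite big_seq_cond (eq_sum_mem l1 l2)//; last first.
  by move=> i /andP[il1 _]; rewrite il1 sub.
by apply: sum_le_pred => // i _ /andP[].
Qed.

Lemma fsum_le_esum A P F : (forall i, 0 <= F i) ->
  ((\sum_(i <- A | P i) F i)%:E <= \esum_(i in [set: I]) (F i)%:E)%E.
Proof.
move=> F0; apply: esum_ge; exists [set` A]; first by split.
rewrite -fsbig_seq ?fset_uniq// sumEFin lee_fin.
by apply: sum_le_pred.
Qed.

(** Passes from extended-real norms to real finite sums, the form in which Hoelder's inequality is
    applied. *)
Lemma poweR_esum_le A P F (s D : R) : (forall i, 0 <= F i) -> 0 < s -> 0 <= D ->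
  (poweR (\esum_(i in [set: I]) (F i)%:E) s^-1 <= D%:E)%E ->
  \sum_(i <- A | P i) F i <= D `^ s.
Proof.
move=> F0 s0 D0 H.
have S0 : 0 <= \sum_(i <- A | P i) F i by exact: sumr_ge0.
have : (\sum_(i <- A | P i) F i) `^ s^-1 <= D.
  rewrite -lee_fin -poweR_EFin; apply: le_trans H.
  apply: gt0_ler_poweR; rewrite ?invr_ge0 ?(ltW s0) ?in_itv /= ?leey ?andbT//.
  - by rewrite esum_ge0// => i _; rewrite lee_fin.
  - exact: fsum_le_esum.
move=> H'; rewrite -[leLHS](powRr1 S0) -(mulVf (lt0r_neq0 s0)) powRrM.
by rewrite ge0_ler_powR ?nnegrE ?powR_ge0 ?(ltW s0).
Qed.

(* Enlarging a finite set on which the sum of the majorants is almost maximal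
   changes the partial sums by little, uniformly. *)
Lemma unconditional_Mtest {U : topologicalType} (K : set U) (P : pred I)
    (u : I -> U -> R) (b : I -> R) (B : R) :
  (forall i, P i -> {within K, continuous (u i)}) ->
  (forall i z, P i -> K z -> `|u i z| <= b i) -> (forall i, P i -> 0 <= b i) ->
  (forall A, \sum_(i <- A | P i) b i <= B) ->
  exists2 g : U -> R, {within K, continuous g} &
    {uniform K, (fun A z => \sum_(i <- A | P i) u i z) @ summability.totally
       --> g}.
Proof.
move=> cu ub b0 bB.
pose S (A : {fset I}) z := \sum_(i <- A | P i) u i z.
have unif (eps : R) : 0 < eps -> exists A0, forall A z, K z -> (A0 `<=` A)%fset ->
    `|S A z - S A0 z| < eps.
  move=> eps0; pose X := [set \sum_(i <- A | P i) b i | A in [set: {fset I}]].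
  have supX : has_sup X.
    split; first by exists (\sum_(i <- fset0 | P i) b i); exists fset0.
    by exists B => _ [A _ <-].
  have [_ [A0 _ <-] hA0] := sup_adherent eps0 supX.
  exists A0 => A z Kz sub.
  have dec (f : I -> R) : \sum_(i <- A | P i) f i =
      \sum_(i <- A0 | P i) f i + \sum_(i <- A | P i && (i \notin A0)) f i.
    rewrite (bigID (fun i => i \in A0)) /=; congr (_ + _).
    rewrite -[LHS]big_filter -[RHS]big_filter; apply: perm_big.
    apply: uniq_perm; rewrite ?filter_uniq ?fset_uniq// => i; rewrite !mem_filter.
    case: (P i) => //=; case iA0 : (i \in A0) => //=.
    by rewrite (fsubsetP sub).
  rewrite /S dec addrAC subrr add0r.
  apply: le_lt_trans (ler_norm_sum _ _ _) _.
  apply: (@le_lt_trans _ _ (\sum_(i <- A | P i && (i \notin A0)) b i)).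
    by apply: ler_sum => i /andP[Pi _]; exact: ub.
  have := dec b; have : \sum_(i <- A | P i) b i <= sup X.
    by apply: ub_le_sup; [case: supX|exists A].
  lra.
have PF : ProperFilter (@summability.totally I) := summability.totally_filter.
have cvg z : K z -> cvg (S A z @[A --> summability.totally]).
  move=> Kz; apply: (@cauchy_cvg R); apply/cauchyP => eps eps0.
  have [A0 HA0] := unif _ eps0; exists (S A0 z); exists A0 => // A sub.
  by rewrite /ball /= distrC; exact: HA0.
pose g z := lim (S A z @[A --> summability.totally]).
have Sg : {uniform K, S @ summability.totally --> g}.
  move=> W /uniform_nbhs[E [entE subW]].
  move: entE; rewrite -entourage_ballE => -[e /= e0 subE].
  have [A0 HA0] := unif _ (divr_gt0 e0 (ltr0n R 3)).
  exists A0 => // A sub; apply: subW => z Kz; apply: subE; rewrite /ball /=.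
  (* [A1] depends on z but [A0] does not; comparing through the union of [A1] and [A] makes the
     estimate uniform in z. *)
  have [A1 _ HA1] : (\forall A \near summability.totally, `|g z - S A z| < e / 3).
    by move/cvgrPdist_lt : (cvg z Kz); apply; rewrite divr_gt0.
  have h1 := HA1 (A1 `|` A)%fset (fsubsetUl _ _).
  have h2 := HA0 (A1 `|` A)%fset z Kz (fsubset_trans sub (fsubsetUr _ _)).
  have h3 := HA0 A z Kz sub.
  have -> : g z - S A z = (g z - S (A1 `|` A)%fset z) +
     (S (A1 `|` A)%fset z - S A0 z) - (S A z - S A0 z) by ring.
  rewrite (le_lt_trans (ler_normB _ _))// (le_lt_trans (lerD (ler_normD _ _) (lexx _)))//.
  by move: h1 h2 h3 => /=; lra.
exists g => //.
apply: (@uniform_limit_continuous_subspace _ _ K (S @ summability.totally)) => //.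
(* Every finite partial sum is continuous, so the empty set is already far enough along the net. *)
exists fset0 => // A _; rewrite /preimage /=.
rewrite /S; elim: (enum_fset A) => [|i l IH].
  apply: (@subspace_eq_continuous _ _ _ (fun=> 0)); last exact: cst_continuous.
  by move=> z _; rewrite /from_subspace big_nil.
case Pi : (P i); last first.
  by under [X in continuous X]eq_fun do rewrite big_cons Pi.
under [X in continuous X]eq_fun do rewrite big_cons Pi.
exact: (within_continuousD (cu _ Pi) IH).
Qed.
End FiniteSums.

(** * Truncation error and noise *)

(** Flattens iterated sums into sums over one list of pairs, so that ranges can be compared by
    membership. *)
Definition box (m : nat) : seq (nat * nat) :=
  [seq (k, j) | k <- index_iota 0 m, j <- index_iota 0 m].

Lemma box_uniq m : uniq (box m).
Proof. by rewrite allpairs_uniq ?iota_uniq// => -[? ?] [? ?]. Qed.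

Lemma mem_box m kj : (kj \in box m) = (kj.1 < m)%N && (kj.2 < m)%N.
Proof.
apply/allpairsP/andP => [[[k j] /= [+ + ->]]|[k1 k2]].
  by rewrite !mem_index_iota.
by exists kj; rewrite !mem_index_iota k1 k2; case: kj {k1 k2}.
Qed.

Section Truncation.
Context {R : realType}.
Implicit Types (r n m M : nat) (A : {fset nat * nat}) (P : pred (nat * nat)).

Lemma sum_box r m (D : nat -> nat -> bool) (F : nat * nat -> R) :
  \sum_(r <= k < m) \sum_(r <= j < m | D k j) F (k, j) =
  \sum_(kj <- box m | [&& r <= kj.1, r <= kj.2 & D kj.1 kj.2]%N) F kj.
Proof.
rewrite [RHS]big_mkcond big_allpairs /=.
rewrite (@big_nat_widenl _ _ _ r 0)// big_mkcond; apply: eq_bigr => k _ /=.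
case: leqP => rk /=; last by rewrite big1.
by rewrite (@big_nat_widenl _ _ _ r 0)// big_mkcond; under eq_bigr do rewrite andbC.
Qed.

Lemma sum_le_hyperbolic A P M (F : nat * nat -> R) : (1 <= M)%N ->
  (forall kj, 0 <= F kj) ->
  (forall kj, P kj -> [&& 1 <= kj.1, 1 <= kj.2 & M <= kj.1 * kj.2]%N) ->
  exists2 K, (M < K)%N & \sum_(kj <- A | P kj) F kj <=
    \sum_(1 <= k < K) \sum_(1 <= j < K | (M <= k * j)%N) F (k, j).
Proof.
(* A crude number exceeding [M] and every coordinate occurring in [A]. *)
move=> M1 F0 PM; pose K := (M + \sum_(kj <- A) (kj.1 + kj.2)).+1.
exists K; first by rewrite ltnS leq_addr.
rewrite sum_box -[leLHS]big_filter -[leRHS]big_filter.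
apply: sum_le_subset => //; rewrite ?filter_uniq ?box_uniq// => kj.
rewrite !mem_filter => /andP[Pkj kjA]; rewrite (PM _ Pkj) mem_box /=.
have : (kj.1 + kj.2 <= \sum_(kj <- A) (kj.1 + kj.2))%N.
  by rewrite (big_rem kj)//= leq_addr.
rewrite /K; move: (\sum_(_ <- _) _)%N => S H.
by apply/andP; split; rewrite ltnS; apply: leq_trans (leq_addl _ _);
   apply: leq_trans H; rewrite (leq_addr, leq_addl).
Qed.

(** Hoelder's inequality with exponents s and 1/(1 - 1/s); the condition on tau says exactly that
    the dual power of the weight is (kj)^(-a) with a > 1. For s = 1 the weight is bounded by its
    supremum M^(-tau) instead. *)
Lemma weighted_tail_le (s tau : R) : 1 <= s -> 1 - s^-1 < tau ->
  exists2 C : R, 0 < C & forall M A P (x : nat * nat -> R), (1 <= M)%N ->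
    (forall kj, P kj -> [&& 1 <= kj.1, 1 <= kj.2 & M <= kj.1 * kj.2]%N) ->
    (forall kj, 0 <= x kj) -> \sum_(kj <- A | P kj) x kj `^ s <= 1 ->
    \sum_(kj <- A | P kj) x kj * (kj.1 * kj.2)%:R `^ (- tau) <=
      C * M%:R `^ (1 - s^-1 - tau) * (1 + ln M%:R) `^ (1 - s^-1).
Proof.
rewrite le_eqVlt => /predU1P[<-|s1] stau.
  rewrite invr1 subrr in stau.
  exists 1 => // M A P x M1 PM x0; rewrite invr1 subrr sub0r powRr0 mulr1 mul1r.
  under eq_bigr do rewrite powRr1//.
  move=> hx; apply: (@le_trans _ _ (\sum_(kj <- A | P kj) x kj * M%:R `^ (- tau))).
    apply: ler_sum => kj /PM /and3P[k1 j1 Mkj]; rewrite ler_wpM2l//.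
    have M0 : 0 < M%:R :> R by rewrite ltr0n.
    have kj0 : 0 < (kj.1 * kj.2)%:R :> R by rewrite ltr0n muln_gt0 k1.
    rewrite !powRN lef_pV2 ?posrE ?powR_gt0//.
    by rewrite ge0_ler_powR ?nnegrE ?(ltW M0) ?(ltW kj0) ?(ltW stau) ?ler_nat.
  by rewrite -big_distrl /= ler_piMl ?powR_ge0.
have s0 : 0 < s by apply: lt_trans s1.
pose c := 1 - s^-1; have c0 : 0 < c by rewrite subr_gt0 invf_lt1.
have a1 : 1 < tau / c by rewrite ltr_pdivlMr// mul1r.
have [C C0 HC] := hyperbolic_tail_le _ a1.
exists (C `^ c); first by rewrite powR_gt0.
move=> M A P x M1 PM x0 hx.
have M0 : 0 < M%:R :> R by rewrite ltr0n.
have lnM0 : 0 < 1 + ln M%:R :> R by rewrite ltr_wpDr// ln_ge0// ler1n.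
pose W := (C * M%:R `^ (1 - tau / c) * (1 + ln M%:R)) `^ c.
have W0 : 0 < W by rewrite powR_gt0// !mulr_gt0// powR_gt0.
have -> : C `^ c * M%:R `^ (1 - s^-1 - tau) * (1 + ln M%:R) `^ (1 - s^-1) = 1 * W.
  rewrite mul1r /W -/c !powRM ?mulr_ge0 ?powR_ge0 ?(ltW C0) ?(ltW lnM0)//.
  rewrite -powRrM; congr (_ * M%:R `^ _ * _); field.
  by rewrite gt_eqF.
apply: (@holder_sum _ _ _ _ _ _ s c^-1) => //.
- by rewrite invr_gt0.
- by rewrite invrK /c subrKC.
- by rewrite powR1.
rewrite /W -powRrM mulfV ?gt_eqF// powRr1; last first.
  by rewrite !mulr_ge0 ?powR_ge0 ?(ltW C0) ?(ltW lnM0).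
have [|K MK H] := sum_le_hyperbolic A P _
    (fun kj => ((kj.1 * kj.2)%:R `^ (- tau)) `^ c^-1) M1 _ PM.
  by move=> kj; exact: powR_ge0.
apply: le_trans H _; apply: le_trans (HC _ _ M1 MK).
by under eq_bigr do under eq_bigr do rewrite -powRrM mulNr.
Qed.

Lemma lp_norm_sum_le A P (p : \bar R) (x : nat * nat -> R) (d S : R) :
  (1 <= p)%E -> 0 < d -> 0 < S -> (lp_norm p x <= d%:E)%E ->
  \sum_(kj <- A | P kj) 1 <= S ->
  \sum_(kj <- A | P kj) `|x kj| <= d * S `^ (1 - rinv p).
Proof.
move=> p1 d0 S0; case: p p1 => [q| |]//=; rewrite ?lee_fin => p1 H HS.
  have q0 : 0 < q by apply: lt_le_trans p1.
  have -> : rinv q%:E = q^-1 by rewrite /rinv inver gt_eqF.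
  apply: sum_le_powR_card => //.
  by apply: poweR_esum_le => //; exact: ltW.
(* For p = oo each term is at most d, and S enters to the full power 1. *)
rewrite (_ : rinv _ = 0); last by rewrite /rinv invey.
rewrite subr0 powRr1 ?(ltW S0)//.
apply: (@le_trans _ _ (\sum_(kj <- A | P kj) d * 1)); last first.
  by rewrite -big_distrr /= ler_wpM2l// ltW.
apply: ler_sum => kj _; rewrite mulr1 -lee_fin; apply: le_trans H.
by apply: ereal_sup_ubound; exists kj.
Qed.

Lemma rinv_itv (p : \bar R) : (1 <= p)%E -> 0 <= rinv p <= 1.
Proof.
case: p => [q| |]//=; rewrite ?lee_fin => p1; last by rewrite /rinv invey /= lexx ler01.
have q0 : 0 < q by apply: lt_le_trans p1.
by rewrite /rinv inver gt_eqF//= invr_ge0 (ltW q0) invf_le1.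
Qed.

End Truncation.

Lemma truncationE (R : realType) (r n : nat) (x : nat * nat -> R) (z : R * R) :
  truncation r n x z =
  \sum_(kj <- box (r * n) | [&& r <= kj.1, r <= kj.2 & kj.1 * kj.2 <= r * n - 1]%N)
    x kj * dlegendre2 r kj z.
Proof.
exact: (sum_box r (r * n) (fun k j => k * j <= r * n - 1)%N
          (fun kj => x kj * dlegendre2 r kj z)).
Qed.

Lemma continuous_dlegendre2 (R : realType) (r : nat) (kj : nat * nat) :
  continuous (@dlegendre2 R r kj).
Proof.
move=> z; apply: cvgM.
  by apply: continuous_comp; [exact: cvg_fst|exact: continuous_horner].
by apply: continuous_comp; [exact: cvg_snd|exact: continuous_horner].
Qed.

Lemma uniform_cvg_totally (R : realType) (I : choiceType) (U : topologicalType)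
    (K : set U) (S : {fset I} -> U -> R) (g : U -> R) (eps : R) :
  {uniform K, S @ summability.totally --> g} -> 0 < eps ->
  exists A0 : {fset I}, forall A z, (A0 `<=` A)%fset -> K z ->
    `|g z - S A z| < eps.
Proof.
move=> Sg eps0.
have [] := Sg [set h | forall z, K z -> `|g z - h z| < eps].
  apply/uniform_nbhs; exists [set xy | ball xy.1 eps xy.2]; split => //.
  exact: entourage_ball (PosNum eps0).
by move=> A0 _ H; exists A0 => A z sub Kz; exact: (H A sub).
Qed.

Lemma class_sum_le (R : realType) (s mu : R) (f : R * R -> R)
    (A : {fset nat * nat}) (P : pred (nat * nat)) :
  1 <= s -> in_class s mu f ->
  \sum_(kj <- A | P kj)
    ((maxn 1 (kj.1 * kj.2))%:R `^ mu * `|coef f kj|) `^ s <= 1.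
Proof.
move=> s1 [_ H]; have s0 : 0 < s by apply: lt_le_trans s1.
under eq_bigr do rewrite powRM ?powR_ge0// -powRrM [mu * s]mulrC.
have E : 1 `^ s = 1 :> R by rewrite powR1.
rewrite -[leRHS]E.
by apply: poweR_esum_le => // kj; rewrite mulr_ge0 ?powR_ge0.
Qed.

(** * The error bound for the truncation method *)

Theorem theorem0p3p4 (R : realType) (r : nat) (p : \bar R) (s mu : R)
    (hr : (1 <= r)%N) (hp : (1 <= p)%E) (hs : 1 <= s)
    (hmu : 2 * r%:R - s^-1 + 3 / 2 < mu)
    (c1 c2 delta0 : R) (hc1 : 0 < c1) (hc2 : 0 < c2)
    (hdelta0 : 0 < delta0 < 1) :
  exists2 c : R, 0 < c &
    forall (f : R * R -> R) (fdelta : nat * nat -> R) (delta : R) (n : nat),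
      in_class s mu f ->
      0 < delta <= delta0 ->
      (lp_norm p (fun kj => coef f kj - fdelta kj)%R <= delta%:E)%E ->
      let N := (delta^-1 * ln (delta^-1) `^ (rinv p - s^-1))
                 `^ (1 / (mu - rinv p + s^-1)) in
      c1 * N <= n%:R <= c2 * N ->
      exists2 g : R * R -> R, is_mixed_deriv r f g &
        (unorm (fun z => g z - truncation r n fdelta z)%R <=
          (c * (delta * ln (delta^-1) `^ (s^-1 - rinv p))
                 `^ ((mu - 2 * r%:R + s^-1 - 3 / 2) / (mu - rinv p + s^-1))
             * ln (delta^-1) `^ (2 - s^-1))%:E)%E.
Proof.
have s0 : 0 < s by apply: lt_le_trans hs.
have sg01 : 0 <= s^-1 <= 1 by rewrite invr_ge0 (ltW s0) invf_le1.
have e01 := rinv_itv p hp.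
have r1 : 1 <= r%:R :> R by rewrite ler1n.
have r0 : 0 < r%:R :> R by rewrite ltr0n.
(* The decay left of the weight (kj)^mu after the growth (kj)^(2r + 1/2) of the differentiated
   polynomials; the hypothesis on mu amounts to tau > 1 - 1/s. *)
pose tau := mu - (2 * r%:R + 2^-1).
have stau : 1 - s^-1 < tau by rewrite /tau; lra.
have [C C0 HC] := weighted_tail_le s tau hs stau.
set be := mu - rinv p + s^-1; set ga := mu - 2 * r%:R + s^-1 - 3 / 2.
have be0 : 0 < be by rewrite /be; lra.
have gabe : 0 <= ga <= be by rewrite /ga /be; apply/andP; split; lra.
(* The rate is expressed through M = r n, hence the factors r. The constant is fixed before f, delta
   and n. *)
have [c c0 Hc] := error_rate be ga (rinv p) s^-1 (c1 * r%:R) (c2 * r%:R) delta0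
  (3 / 2 * C) (3 / 2) be0 gabe e01 sg01 (mulr_gt0 hc1 r0) (mulr_gt0 hc2 r0)
  hdelta0 (mulr_gt0 (divr_gt0 (ltr0n R 3) (ltr0n R 2)) C0)
  (divr_gt0 (ltr0n R 3) (ltr0n R 2)).
exists c => // f fd d n fc dd0 lpd N /andP[c1N nc2].
have /andP[d0 _] := dd0.
have L0 : 0 < ln d^-1.
  have /andP[_ d01] := hdelta0; have /andP[_ ddelta] := dd0.
  by rewrite ln_gt0// invf_gt1// (le_lt_trans ddelta).
have N0 : 0 < N by rewrite powR_gt0// mulr_gt0 ?invr_gt0 ?powR_gt0.
have n0 : (0 < n)%N by rewrite -(ltr0n R) (lt_le_trans _ c1N)// mulr_gt0.
set M := (r * n)%N; have M1 : (1 <= M)%N by rewrite muln_gt0 hr.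
have M1r : 1 <= M%:R :> R by rewrite ler1n.
have cN : c1 * r%:R * N <= M%:R <= c2 * r%:R * N.
  by rewrite natrM ![_ * r%:R]mulrC -!mulrA !ler_pM2l// c1N.
have {Hc} Hc := Hc d M%:R dd0 M1r cN.
pose w (kj : nat * nat) : R := (maxn 1 (kj.1 * kj.2))%:R `^ mu * `|coef f kj|.
have w0 kj : 0 <= w kj by rewrite mulr_ge0 ?powR_ge0.
have h32 : 0 <= 3 / 2 :> R by lra.
have wle A P : \sum_(kj <- A : {fset nat * nat} | P kj) w kj `^ s <= 1.
  exact: class_sum_le.
pose Pr (kj : nat * nat) := (r <= kj.1)%N && (r <= kj.2)%N.
have Pr1 kj : Pr kj -> (1 <= kj.1)%N && (1 <= kj.2)%N.
  by move=> /andP[rk rj]; rewrite !(leq_trans hr).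
have dle kj (z : R * R) : Pr kj -> square z ->
    `|dlegendre2 r kj z| <= 3 / 2 * (kj.1 * kj.2)%:R `^ (2 * r%:R + 2^-1).
  by move=> /Pr1 /andP[k1 j1] Qz; case: kj k1 j1 => k j /= k1 j1; apply: dlegendre2_le.
pose u (kj : nat * nat) z := coef f kj * dlegendre2 r kj z.
(* For k, j >= 1 this equals (3/2) |c_kj| (kj)^(2r + 1/2), with c_kj the exact coefficient. *)
pose b (kj : nat * nat) : R := 3 / 2 * (w kj * (kj.1 * kj.2)%:R `^ (- tau)).
have ub kj z : Pr kj -> square z -> `|u kj z| <= b kj.
  move=> Pkj Qz; have /andP[k1 j1] := Pr1 _ Pkj.
  have kj0 : (0 < kj.1 * kj.2)%N by rewrite muln_gt0 k1.
  rewrite normrM /b /w (maxn_idPr kj0) [X in 3 / 2 * X]mulrAC -powRD; last first.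
    by rewrite pnatr_eq0 -lt0n kj0 implybT.
  rewrite (_ : mu + - tau = 2 * r%:R + 2^-1); last by rewrite /tau; ring.
  by rewrite [3 / 2 * _]mulrA mulrC ler_wpM2r// dle.
(* Used twice: m = 1 gives uniform convergence of the series, m = M the truncation error. *)
have bsum A (P : pred (nat * nat)) m : (1 <= m)%N ->
    (forall kj, P kj -> [&& 1 <= kj.1, 1 <= kj.2 & m <= kj.1 * kj.2]%N) ->
    \sum_(kj <- A : {fset nat * nat} | P kj) b kj <=
      3 / 2 * C * m%:R `^ (1 - s^-1 - tau) * (1 + ln m%:R) `^ (1 - s^-1).
  move=> m1 Pm; rewrite -big_distrr /=.
  rewrite [leRHS](_ : _ = 3 / 2 * (C * m%:R `^ (1 - s^-1 - tau) *
    (1 + ln m%:R) `^ (1 - s^-1))); last by rewrite !mulrA.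
  by apply: (ler_wpM2l h32); exact: HC.
have [|||g cg Sg] := @unconditional_Mtest R _ _ (@square R) Pr u b _ _ ub _
  (fun A => bsum A Pr 1%N isT _).
- move=> kj _; apply: continuous_subspaceT => z.
  by apply: cvgM; [exact: cvg_cst|exact: continuous_dlegendre2].
- by move=> kj _; rewrite mulr_ge0 ?mulr_ge0 ?powR_ge0.
- by move=> kj /Pr1 /andP[k1 j1]; rewrite k1 j1 muln_gt0 k1.
exists g; first by split.
apply: ge_ereal_sup => _ [z Qz <-]; rewrite lee_fin; apply: le_trans Hc.
apply/ler_addgt0Pr => eps eps0.
have [A0 HA0] := uniform_cvg_totally _ _ _ _ _ _ _ Sg eps0.
(* Large enough for the partial sum to be within eps of g and to contain every index of the
   truncation. *)
pose A := (A0 `|` [fset kj in box M])%fset.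
have gA : `|g z - \sum_(kj <- A | Pr kj) u kj z| < eps.
  by apply: HA0 => //; exact: fsubsetUl.
pose D (kj : nat * nat) := (kj.1 * kj.2 <= M - 1)%N.
have boxD kj : Pr kj && D kj -> kj \in box M.
  move=> /andP[/Pr1 /andP[k1 j1]]; rewrite /D mem_box => kjM.
  have {}kjM : (kj.1 * kj.2 < M)%N by rewrite -(prednK M1) ltnS -subn1.
  apply/andP; split; apply: leq_ltn_trans kjM; first exact: leq_pmulr.
  exact: leq_pmull.
(* Three parts: the remainder below eps, the discarded terms k j >= M, and the noise on k j < M. *)
have split_sum : g z - truncation r n fd z =
    (g z - \sum_(kj <- A | Pr kj) u kj z)
    + \sum_(kj <- A | Pr kj && ~~ D kj) u kj z
    + \sum_(kj <- A | Pr kj && D kj) (coef f kj - fd kj) * dlegendre2 r kj z.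
  have -> : truncation r n fd z =
      \sum_(kj <- A | Pr kj && D kj) fd kj * dlegendre2 r kj z.
    rewrite truncationE; under eq_bigl do rewrite andbA.
    apply: eq_sum_mem; rewrite ?fset_uniq ?box_uniq//.
    by move=> kj /boxD kjM; rewrite kjM !inE /= kjM orbT.
  under [X in _ = _ + X]eq_bigr do rewrite mulrBl.
  rewrite sumrB [\sum_(kj <- A | Pr kj) _](bigID D) /= -/(u _ _) /u.
  move: (\sum_(_ <- _ | _ && ~~ _) _) (\sum_(_ <- _ | _) coef _ _ * _).
  by move: (\sum_(_ <- _ | _) _) => x1 x2 x3; ring.
rewrite split_sum.
apply: le_trans (ler_normD _ _) _.
apply: le_trans (lerD (ler_normD _ _) (lexx _)) _.
rewrite -addrA addrC; apply: lerD; last exact: ltW.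
apply: lerD.
  apply: le_trans (ler_norm_sum _ _ _) _.
  apply: (@le_trans _ _ (\sum_(kj <- A | Pr kj && ~~ D kj) b kj)).
    by apply: ler_sum => kj /andP[Pkj _]; exact: ub.
  rewrite (_ : - ga = 1 - s^-1 - tau); last by rewrite /ga /tau; field; rewrite gt_eqF.
  apply: bsum => // kj /andP[/Pr1 /andP[-> ->]].
  by rewrite /D -ltnNge subn1 prednK.
apply: le_trans (ler_norm_sum _ _ _) _.
have lnM : 0 <= ln M%:R :> R by rewrite ln_ge0.
(* On k j < M the polynomial factors are at most their bound at k j = M, which leaves the l_1 sum of
   the noise. *)
apply: (@le_trans _ _ (3 / 2 * M%:R `^ (2 * r%:R + 2^-1) *
    \sum_(kj <- A | Pr kj && D kj) `|coef f kj - fd kj|)).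
  rewrite big_distrr /=; apply: ler_sum => kj /andP[Pkj Dkj].
  rewrite normrM [leLHS]mulrC; apply: ler_wpM2r => //.
  apply: le_trans (dle _ _ Pkj Qz) _.
  apply: (ler_wpM2l h32); apply: ge0_ler_powR; rewrite ?nnegrE//.
  by rewrite ler_nat; apply: leq_trans Dkj _; exact: leq_subr.
rewrite (_ : be - ga - (1 - rinv p) = 2 * r%:R + 2^-1); last first.
  by rewrite /be /ga; field; rewrite gt_eqF.
apply: ler_wpM2l; first by rewrite mulr_ge0 ?powR_ge0.
have M0 : 0 < M%:R :> R by rewrite (lt_le_trans ltr01).
have lnM1 : 0 < 1 + ln M%:R :> R by rewrite ltr_wpDr.
apply: lp_norm_sum_le => //; first exact: mulr_gt0.
rewrite (@eq_sum_mem R _ A (box M)) ?fset_uniq ?box_uniq//; last first.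
  by move=> kj /boxD kjM; rewrite kjM !inE /= kjM orbT.
under eq_bigl do rewrite -andbA.
rewrite -(sum_box r M (fun k j => k * j <= M - 1)%N (fun=> 1)).
exact: hyperbolic_count_le.
Qed.
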